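(* Let $\omega_+$ be a holomorphic symplectic form on a (real, smooth) manifold $M$ with associated complex structure $J^{(0)}$. Let $$\varpi(\zeta)=-\frac{i}{2\zeta}\omega_++\omega_3-\frac{i}{2}\zeta\,\omega_-$$ be a family of holomorphic symplectic forms on $M$ labeled by $\zeta\in\mathbb{C}^\times$, with $\omega_-=\overline{\omega_+}$ and $\overline{\omega_3}=\omega_3$. Let $J^{(\zeta)}$ be the complex structure defined by $\varpi(\zeta)$ for $\zeta\in\mathbb{C}^\times$, and $J^{(\infty)}$ the one defined by $\omega_-$. Then: (a) $J^{(-1/\bar\zeta)}=-J^{(\zeta)}$ for all $\zeta\in\mathbb{P}^1$. (b) $\omega_3\in\Omega^{1,1}(M^{(0)})$ and, moreover, $\omega_3$ is non-degenerate. (c) There is an isomorphism $\kappa:T^{(0,1)}M^{(0)}\to T^{(1,0)}M^{(0)}$ such that $T^{(0,1)}M^{(\zeta)}=(1+\zeta\kappa)\,T^{(0,1)}M^{(0)}$ for all $\zeta\in\mathbb{C}$. Explicitly, using the non-degeneracy of $\omega_+$ on $T^{(1,0)}M^{(0)}$, $\kappa$ is defined by $$\iota_{\kappa v}\omega_+=-2i\,\iota_v\omega_3\qquad (v\in T^{(0,1)}M^{(0)}).$$ Moreover, $\kappa$ satisfies $\iota_{\kappa v}\omega_3=\frac{i}{2}\,\iota_v\omega_-$ for $v\in T^{(0,1)}M^{(0)}$.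
   Context: Holomorphic symplectic form on a real manifold $M$: a closed complex-valued 2-form $\Omega$, regarded as a map $\Omega:T_{\mathbb{C}}M\to T^*_{\mathbb{C}}M$ with $T_{\mathbb{C}}M=TM\otimes\mathbb{C}$, such that $T_{\mathbb{C}}M=\ker\Omega\oplus\ker\bar\Omega$. Such an $\Omega$ determines a unique complex structure on $M$ for which $\Omega$ is a holomorphic symplectic form in the usual sense (the ''associated'' complex structure); it is given by $T^{(0,1)}M=\ker\Omega$, $T^{(1,0)}M=\ker\bar\Omega$. $M^{(\zeta)}$ denotes the complex manifold $(M,J^{(\zeta)})$, and $T^{(1,0)}M^{(\zeta)}$, $T^{(0,1)}M^{(\zeta)}\subset T_{\mathbb{C}}M$ are the $\pm i$ eigenbundles of $J^{(\zeta)}$. $\Omega^{1,1}(M^{(0)})$ is the space of $(1,1)$-forms with respect to $J^{(0)}$. $\iota_v$ denotes the interior product. $\mathbb{P}^1=\mathbb{C}\cup\{\infty\}$, with antipodal map $\zeta\mapsto-1/\bar\zeta$ exchanging $0$ and $\infty$. *)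

(* Defs.v *)
From HB Require Import structures.
From mathcomp Require Import all_boot all_order all_algebra.
From mathcomp Require Import complex.
From mathcomp Require Import all_classical all_reals all_analysis.

Set Implicit Arguments.
Unset Strict Implicit.
Unset Printing Implicit Defensive.
Import Order.TTheory GRing.Theory Num.Theory.
Import numFieldNormedType.Exports.
Local Open Scope classical_set_scope.
Local Open Scope ring_scope.
Local Open Scope complex_scope.

(* Smoothness is infinite Frechet differentiability: at every order all the
   iterated directional derivatives are differentiable. *)
Fixpoint diffn_on (R : realType) (n : nat) (V : normedModType R) (k : nat)
    (U : set 'rV[R]_n) (f : 'rV[R]_n -> V) : Prop :=
  if k is k'.+1 then
    (forall x, U x -> differentiable f x) /\
    (forall v, diffn_on k' U (fun x => 'D_v f x))
  else True.

Definition smooth_on (R : realType) (n : nat) (V : normedModType R)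
    (U : set 'rV[R]_n) (f : 'rV[R]_n -> V) : Prop :=
  forall k, diffn_on k U f.

Definition csmooth_on (R : realType) (n : nat) (U : set 'rV[R]_n)
    (f : 'rV[R]_n -> R[i]) : Prop :=
  smooth_on U (fun x => complex.Re (f x) : R) /\ smooth_on U (fun x => complex.Im (f x) : R).

Definition Ci {R : realType} : R[i] := 0 +i* 1.

Definition cderive (R : realType) (n : nat) (v : 'rV[R]_n)
    (f : 'rV[R]_n -> R[i]) (x : 'rV[R]_n) : R[i] :=
  'D_v (fun y => complex.Re (f y) : R) x +i* 'D_v (fun y => complex.Im (f y) : R) x.

(* [cmap] and [cinv] are total; only their values on [cdom] and on
   [cmap @` cdom] matter. *)
Record chart (R : realType) (n : nat) (M : topologicalType) := Chart {
  cdom : set M;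
  cmap : M -> 'rV[R]_n;
  cinv : 'rV[R]_n -> M;
  cdom_open : open cdom;
  cimg_open : open (cmap @` cdom);
  cmapK : forall p, cdom p -> cinv (cmap p) = p;
  cmap_cts : forall p, cdom p -> {for p, continuous cmap};
  cinv_cts : forall p, cdom p -> {for cmap p, continuous cinv} }.

(* A preferred chart [chart_at p] around each point is part of the data: it is
   what identifies T_pM with R^n below. *)
Record manifold (R : realType) (n : nat) := Manifold {
  msort :> topologicalType;
  m_hausdorff : hausdorff_space msort;
  m_countable : @second_countable msort;
  atlas : set (chart R n msort);
  chart_at : msort -> chart R n msort;
  chart_atP : forall p, atlas (chart_at p) /\ cdom (chart_at p) p;
  transition_smooth : forall c d, atlas c -> atlas d ->
    smooth_on (cmap c @` (cdom c `&` cdom d)) (cmap d \o cinv c) }.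

Section Tensors.
Variables (R : realType) (n : nat) (M : manifold R n).
Local Notation C := R[i].

Definition cplx (A : 'M[R]_n) : 'M[C]_n := map_mx (real_complex R) A.

(* T_pM is 'rV[R]_n, the coordinates of tangent vectors in [chart_at p], and
   the fibre of T_C M at p is 'rV[C]_n.  All linear maps act on row vectors
   from the right.  Subbundles of T_C M are given by the row spaces of square
   matrices.  A complex 2-form is given by its Gram matrices, so that
   w(u, v) = u *m w p *m v^T, and the 1-form iota_u w is the row vector
   u *m w p; in particular ker w is [kermx (w p)]. *)
Definition real_endo := M -> 'M[R]_n.
Definition cfield := M -> 'rV[C]_n.
Definition cform2 := M -> 'M[C]_n.
Definition cendo := M -> 'M[C]_n.
Definition csubbundle := M -> 'M[C]_n.

(* Change of coordinates on T_pM from [chart_at p] to c, and back. *)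
Definition to_chart (c : chart R n M) (p : M) : 'M[R]_n :=
  'J (cmap c \o cinv (chart_at p)) (cmap (chart_at p) p).

Definition of_chart (c : chart R n M) (p : M) : 'M[R]_n :=
  'J (cmap (chart_at p) \o cinv c) (cmap c p).

Definition field_in (c : chart R n M) (V : cfield) (x : 'rV[R]_n) : 'rV[C]_n :=
  V (cinv c x) *m cplx (to_chart c (cinv c x)).

Definition form2_in (c : chart R n M) (w : cform2) (x : 'rV[R]_n) : 'M[C]_n :=
  let B := cplx (of_chart c (cinv c x)) in B *m w (cinv c x) *m B^T.

Definition smooth_field (U : set M) (V : cfield) : Prop :=
  forall c, atlas c -> forall j : 'I_n,
    csmooth_on (cmap c @` (cdom c `&` U)) (fun x => field_in c V x 0 j).

Definition is_form2 (w : cform2) : Prop :=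
  (forall p, (w p)^T = - w p) /\
  (forall c, atlas c -> forall i j : 'I_n,
    csmooth_on (cmap c @` cdom c) (fun x => form2_in c w x i j)).

Definition dform2_in (c : chart R n M) (w : cform2) (x : 'rV[R]_n)
    (i j k : 'I_n) : C :=
  cderive (delta_mx 0 i) (fun y => form2_in c w y j k) x
  + cderive (delta_mx 0 j) (fun y => form2_in c w y k i) x
  + cderive (delta_mx 0 k) (fun y => form2_in c w y i j) x.

Definition closed_form2 (w : cform2) : Prop :=
  forall c, atlas c -> forall p, cdom c p ->
    forall i j k : 'I_n, dform2_in c w (cmap c p) i j k = 0.

Definition conj_form2 (w : cform2) : cform2 := fun p => map_mx (@conjc R) (w p).

Definition kernels_split (w : 'M[C]_n) : Prop :=
  (kermx w :&: kermx (map_mx (@conjc R) w) = 0)%MS /\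
  (kermx w + kermx (map_mx (@conjc R) w) :=: 1%:M)%MS.

Definition hol_symplectic (w : cform2) : Prop :=
  [/\ is_form2 w, closed_form2 w & forall p, kernels_split (w p)].

Definition T10 (J : real_endo) : csubbundle :=
  fun p => eigenspace (cplx (J p)) Ci.

Definition T01 (J : real_endo) : csubbundle :=
  fun p => eigenspace (cplx (J p)) (- Ci).

Definition is_assoc_at (w : 'M[C]_n) (A : 'M[R]_n) : Prop :=
  (eigenspace (cplx A) (- Ci) :=: kermx w)%MS /\
  (eigenspace (cplx A) Ci :=: kermx (map_mx (@conjc R) w))%MS.

(* The tensor J with T01 J = ker w and T10 J = ker \bar w.  These conditions
   determine J (see [assoc_cplxP] and [is_assoc_at_inj]), and the smoothness
   and integrability of J follow from those of w and from dw = 0. *)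
Definition assoc_cplx (w : cform2) : real_endo :=
  fun p => xget 0 [set A | is_assoc_at (w p) A].

Definition is_form11 (J : real_endo) (w : cform2) : Prop :=
  is_form2 w /\ forall p (u v : 'rV[C]_n),
    ((u <= T10 J p)%MS && (v <= T10 J p)%MS) ||
    ((u <= T01 J p)%MS && (v <= T01 J p)%MS) ->
    u *m w p *m v^T = 0.

Definition nondegenerate_form2 (w : cform2) : Prop :=
  forall p (v : 'rV[C]_n), v *m w p = 0 -> v = 0.

(* A linear map E -> F is the restriction to E of an endomorphism k of T_C M,
   whose values outside of E are irrelevant.  Both k and its inverse are
   smooth on sections. *)
Definition bundle_iso (E F : csubbundle) (k : cendo) : Prop :=
  (forall p, (E p *m k p :=: F p)%MS /\ (E p :&: kermx (k p) = 0)%MS) /\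
  (forall (U : set M) (V : cfield), open U ->
    (forall p, U p -> (V p <= E p)%MS) ->
    (smooth_field U V <-> smooth_field U (fun p => V p *m k p))).

Definition varpi (wp w3 : cform2) (z : C) : cform2 := fun p =>
  - (Ci / (2 * z)) *: wp p + w3 p - (Ci / 2 * z) *: conj_form2 wp p.

(* P^1 = C + {oo} is [option C], with [None] for oo. *)
Definition antipode (z : option C) : option C :=
  if z is Some a then if a == 0 then None else Some (- (conjc a)^-1)
  else Some 0.

Definition twistor_form (wp w3 : cform2) (z : option C) : cform2 :=
  if z is Some a then if a == 0 then wp else varpi wp w3 a
  else conj_form2 wp.

Definition Jtw (wp w3 : cform2) (z : option C) : real_endo :=
  assoc_cplx (twistor_form wp w3 z).

Lemma assoc_at_exists (w : 'M[C]_n) :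
  kernels_split w -> exists A, is_assoc_at w A.
Proof.
move=> [dx sx]; set K := kermx w in dx sx *; set L := kermx _ in dx sx *.
have conjK m (B : 'M[C]_(m, n)) : map_mx (@conjc R) (map_mx (@conjc R) B) = B.
  by apply/matrixP=> i j; rewrite !mxE conjcK.
have KL (u : 'rV[C]_n) : (u <= K)%MS -> (map_mx (@conjc R) u <= L)%MS.
  by move=> /sub_kermxP h; apply/sub_kermxP; rewrite -map_mxM h map_mx0.
have LK (u : 'rV[C]_n) : (u <= L)%MS -> (map_mx (@conjc R) u <= K)%MS.
  move=> /sub_kermxP h; apply/sub_kermxP.
  by rewrite -[w]conjK -map_mxM h map_mx0.
pose P := proj_mx K L; pose A : 'M[R]_n := map_mx (fun z : C => 2 * complex.Im z) P.
have AE : cplx A = - Ci *: P + Ci *: map_mx (@conjc R) P.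
  rewrite /A /Ci; apply/matrixP=> i j; move: (P) => Q; rewrite !mxE.
  case: (Q i j) => a b /=; apply/eqP; rewrite eq_complex /=.
  by apply/andP; split; apply/eqP; simpc; rewrite ?subrr ?addNr // mulr_natl.
have PK u : (u <= K)%MS -> u *m P = u :> 'rV_n by move=> h; rewrite proj_mx_id.
have PL u : (u <= L)%MS -> u *m P = 0 :> 'rV_n by move=> h; rewrite proj_mx_0.
have QE (u : 'rV[C]_n) :
    u *m map_mx (@conjc R) P = map_mx (@conjc R) (map_mx (@conjc R) u *m P).
  by rewrite [RHS]map_mxM conjK.
have AK u : (u <= K)%MS -> u *m cplx A = - Ci *: u :> 'rV_n.
  move=> h; rewrite AE mulmxDr -!scalemxAr PK // QE PL ?KL // map_mx0.
  by rewrite scaler0 addr0.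
have AL u : (u <= L)%MS -> u *m cplx A = Ci *: u :> 'rV_n.
  move=> h; rewrite AE mulmxDr -!scalemxAr PL // QE PK ?LK // conjK.
  by rewrite scaler0 add0r.
have ii : (Ci : C) - - Ci != 0.
  by rewrite /Ci eq_complex negb_and /=; simpc; rewrite -mulr2n pnatr_eq0 orbT.
have dec (u : 'rV[C]_n) : exists a b : 'rV[C]_n,
    [/\ (a <= K)%MS, (b <= L)%MS & u = a + b].
  have /sub_addsmxP[[x y] /= ->] : (u <= K + L)%MS by rewrite sx submx1.
  by exists (x *m K), (y *m L); split; rewrite ?submxMl.
have eqi (v : 'rV[C]_n) : Ci *: v = - Ci *: v -> v = 0.
  move=> /eqP; rewrite -subr_eq0 -scalerBl scaler_eq0 (negPf ii) /=.
  by move=> /eqP.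
exists A; move: A AK AL {AE} => A AK AL; split; apply/eqmxP/andP; split; apply/rV_subP => u.
- move=> /eigenspaceP; have [a [b [aK bL ->]]] := dec u.
  rewrite mulmxDl (AK _ aK) (AL _ bL) scalerDr => /addrI /eqi b0.
  rewrite b0 addr0; exact: aK.
- by move=> h; apply/eigenspaceP; exact: AK.
- move=> /eigenspaceP; have [a [b [aK bL ->]]] := dec u.
  rewrite mulmxDl (AK _ aK) (AL _ bL) scalerDr => /addIr /esym /eqi a0.
  rewrite a0 add0r; exact: bL.
- by move=> h; apply/eigenspaceP; exact: AL.
Qed.

Lemma is_assoc_at_inj (w : 'M[C]_n) (A B : 'M[R]_n) :
  kernels_split w -> is_assoc_at w A -> is_assoc_at w B -> A = B.
Proof.
move=> [_ sx] [A1 A2] [B1 B2].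
suff h : cplx A = cplx B.
  by apply/matrixP => i j; have /matrixP/(_ i j) := h; rewrite !mxE => -[].
apply/row_matrixP => i; rewrite !rowE.
have /sub_addsmxP[[x y] /= ->] :
    ((delta_mx 0 i : 'rV[C]_n) <= kermx w + kermx (map_mx (@conjc R) w))%MS.
  by rewrite sx submx1.
have h1 D : (eigenspace (cplx D) (- Ci) :=: kermx w)%MS ->
    x *m kermx w *m cplx D = - Ci *: (x *m kermx w).
  by move=> e; apply/eigenspaceP; rewrite e submxMl.
have h2 D :
    (eigenspace (cplx D) Ci :=: kermx (map_mx (@conjc R) w))%MS ->
    y *m kermx (map_mx (@conjc R) w) *m cplx D
    = Ci *: (y *m kermx (map_mx (@conjc R) w)).
  by move=> e; apply/eigenspaceP; rewrite e submxMl.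
move: (h1 A A1) (h1 B B1) (h2 A A2) (h2 B B2).
move: (x *m _) (y *m _) => a b ha hb ka kb.
by rewrite [LHS]mulmxDl [RHS]mulmxDl ha hb ka kb.
Qed.

Lemma assoc_cplxP (w : cform2) p :
  kernels_split (w p) -> is_assoc_at (w p) (assoc_cplx w p).
Proof.
move=> /assoc_at_exists [A hA].
exact: (@xgetPex _ 0 [set A | is_assoc_at (w p) A] (ex_intro _ A hA)).
Qed.

End Tensors.

(* Main.v *)
Require Import Defs.
From HB Require Import structures.
From mathcomp Require Import all_boot all_order all_algebra.
From mathcomp Require Import complex.
From mathcomp Require Import all_classical all_reals all_analysis.
From mathcomp Require Import ring zify.
Import Order.TTheory GRing.Theory Num.Theory.
Import numFieldNormedType.Exports.
Local Open Scope ring_scope.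
Local Open Scope complex_scope.

Set Implicit Arguments.
Unset Strict Implicit.

(* At a point, write W, V for the Gram matrices of w_+, w_3, so that
   T_C = K + L with K = ker W and L = ker \bar W.  All the forms varpi(z) have
   the rank of W, and for almost all z the L x L block of varpi(z) already has
   this rank; so its kernel consists of the vectors v + z a(z), where a(z) in L
   depends rationally on z and v runs through K.  Pairing v + z a(z) with K and
   letting z tend to 0 gives V(K, K) = 0, hence also V(L, L) = 0.

   The map kappa is the restriction of the endomorphism -2i V S^-1, where
   S = W + \bar W is twice the real part of W.  It is an involution exchanging
   K and L; being defined globally from smooth tensors, it gives the
   smoothness of kappa and of its inverse at the same time. *)

(** * Linear algebra of a twistor family *)

(** The product [p * d] vanishes everywhere, in particular at the naturals, which are pairwise
    distinct in a numeric field and outnumber the possible roots of a nonzero polynomial. *)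
Lemma poly_eq0_cofinite (F : numFieldType) (p d : {poly F}) :
  d != 0 -> (forall z, d.[z] != 0 -> p.[z] = 0) -> p = 0.
Proof.
move=> d0 pd; apply/eqP; have := mulf_eq0 p d; rewrite (negPf d0) orbF => <-.
apply: contraT => q0; pose s : seq F := [seq i%:R | i <- iota 0 (size (p * d))].
have : (size s < size (p * d)%R)%N.
  apply: (max_poly_roots q0); last first.
    by rewrite map_inj_uniq ?iota_uniq // => a b /eqP; rewrite eqr_nat => /eqP.
  apply/allP => z _; rewrite rootE hornerM mulf_eq0.
  by have [_|/pd ->] := eqVneq d.[z] 0; rewrite ?eqxx ?orbT.
by rewrite size_map size_iota ltnn.
Qed.

(** Right multiplication by [D] can only enlarge the kernel, and the rank bound excludes a strict
    enlargement. *)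
Lemma kermx_mulr_eq (F : fieldType) (n k : nat) (N : 'M[F]_n) (D : 'M[F]_(n, k)) :
  (\rank N <= \rank (N *m D))%N -> (kermx (N *m D) <= kermx N)%MS.
Proof.
move=> h; have sub : (kermx N <= kermx (N *m D))%MS.
  by apply/sub_kermxP; rewrite mulmxA mulmx_ker mul0mx.
rewrite -(geq_leqif (mxrank_leqif_sup sub)) !mxrank_ker.
exact: leq_sub2l.
Qed.

Lemma unitmx_row_inj (F : fieldType) (k : nat) (A : 'M[F]_k) :
  (forall u : 'rV_k, u *m A = 0 -> u = 0) -> A \in unitmx.
Proof.
move=> h; rewrite -row_free_unit -kermx_eq0; apply/eqP/row_matrixP => i.
by rewrite row0; apply: h; rewrite -row_mul mulmx_ker row0.
Qed.

(** Two kernels of equal dimension n - rank fill the space. Applied to a form and its conjugate,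
    this forces every member of the family to have rank n/2. *)
Lemma rank_complementary_kernels (F : fieldType) (n : nat) (A B : 'M[F]_n) :
  \rank B = \rank A -> (kermx A :&: kermx B = 0)%MS ->
  (kermx A + kermx B :=: 1%:M)%MS -> ((\rank A).*2 = n)%N.
Proof.
move=> e dx sx; have := mxrank_disjoint_sum dx.
rewrite sx mxrank1 !mxrank_ker e.
by have := rank_leq_row A; lia.
Qed.

Lemma combine_blocks (F : comNzRingType) (n : nat) (d z c : F) (a b w : 'M[F]_n) :
  d *: (z *: a - (c * z ^+ 2) *: w) - z *: (z *: b)
  = z *: (d *: a - z *: ((c * d) *: w + b)).
Proof. by apply/matrixP => i j; rewrite !mxE; ring. Qed.

Lemma mx_eq0_bilinear (F : pzRingType) (m n : nat) (A : 'M[F]_(m, n)) :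
  (forall (u : 'rV_m) (v : 'rV_n), u *m A *m v^T = 0) -> A = 0.
Proof.
move=> h; apply/matrixP => i j; rewrite [RHS]mxE.
have := h (delta_mx 0 i) (delta_mx 0 j).
by rewrite trmx_delta -rowE -colE => /matrixP /(_ 0 0); rewrite !mxE.
Qed.

Lemma Ci_sqr (R : realType) : Ci * Ci = -1 :> R[i].
Proof. by apply/eqP; rewrite eq_complex /=; simpc. Qed.

Lemma Ci_neq0 (R : realType) : Ci != 0 :> R[i].
Proof. by rewrite /Ci eq_complex /= oner_eq0 andbF. Qed.

Lemma conjc_Ci (R : realType) : conjc (Ci : R[i]) = - Ci.
Proof. by rewrite /Ci; simpc. Qed.

Lemma conjcE (R : realType) :
  (((forall x y : R[i], (conjc (x + y) = conjc x + conjc y)%R)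
   * (forall x y : R[i], (conjc (x * y) = conjc x * conjc y)%R))
  * ((forall x : R[i], (conjc (- x) = - conjc x)%R)
   * (forall x : R[i], (conjc x^-1 = (conjc x)^-1)%R)) * (conjc (2 : R[i]) = 2)%R)%type.
Proof.
split; last exact: (rmorph_nat (@conjc R) 2).
split; split; [exact: rmorphD|exact: rmorphM|exact: rmorphN|exact: fmorphV].
Qed.

Section TwistorAlgebra.
Variables (R : realType) (n : nat).
Local Notation C := R[i].
Implicit Types (W V : 'M[C]_n).

Local Notation conj := (map_mx (@conjc R)).

Lemma conj_mxK (m k : nat) (A : 'M[C]_(m, k)) : conj (conj A) = A.
Proof. by apply/matrixP => i j; rewrite !mxE conjcK. Qed.

Lemma rank_kernels_split W : kernels_split W -> ((\rank W).*2 = n)%N.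
Proof.
by move=> [dx sx]; apply: (rank_complementary_kernels _ dx sx); rewrite mxrank_map.
Qed.

Lemma kernels_split_conj W : kernels_split W -> kernels_split (conj W).
Proof.
move=> [dx sx]; split; rewrite conj_mxK.
  by rewrite capmxC; exact: dx.
by rewrite addsmxC; exact: sx.
Qed.

(** Negating [A] swaps its i and -i eigenspaces, just as conjugating [W] swaps the two kernels. *)
Lemma is_assoc_at_conj W (A : 'M[R]_n) :
  is_assoc_at W A -> is_assoc_at (conj W) (- A).
Proof.
have cN (a : C) : (eigenspace (cplx (- A)) a :=: eigenspace (cplx A) (- a))%MS.
  apply/eqmxP/andP; split; apply/rV_subP => u /eigenspaceP;
    rewrite /cplx map_mxN => h; apply/eigenspaceP; last by rewrite mulmxN h scaleNr opprK.
  by rewrite scaleNr -h mulmxN opprK.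
move=> [h1 h2]; split; first by apply: eqmx_trans (cN _) _; rewrite opprK.
by apply: eqmx_trans (cN _) _; rewrite conj_mxK.
Qed.

Definition twistor_mx W V (z : C) : 'M[C]_n :=
  - (Ci / (2 * z)) *: W + V - (Ci / 2 * z) *: conj W.

(** Conjugation exchanges the terms in 1/z and z and fixes the real middle term; this is the
    pointwise content of part (a). *)
Lemma conj_twistor_mx W V (z : C) : z != 0 -> conj V = V ->
  conj (twistor_mx W V z) = twistor_mx W V (- (conjc z)^-1).
Proof.
move=> z0 hV; rewrite /twistor_mx; apply/matrixP => i j.
have hVij : conjc (V i j) = V i j by rewrite -[in RHS]hV mxE.
rewrite !mxE.
rewrite !conjcE hVij conjc_Ci conjcK.
have cz0 : conjc z != 0 by rewrite conjc_eq0.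
have two0 : (2 : C) != 0 by rewrite pnatr_eq0.
move: (W i j) (conjc _) (conjc z) cz0 => a b t t0.
by field; rewrite ?t0 ?two0 ?oppr_eq0 ?oner_eq0 ?pnatr_eq0.
Qed.

Variables (W V : 'M[C]_n).
Hypotheses (W_alt : W^T = - W) (V_real : conj V = V).
Hypothesis W_split : kernels_split W.
Hypothesis twistor_split : forall z, z != 0 -> kernels_split (twistor_mx W V z).

Let K := kermx W.
Let L := kermx (conj W).
Let S := W + conj W.

Lemma conjW_alt : (conj W)^T = - conj W.
Proof. by rewrite map_trmx W_alt map_mxN. Qed.

Lemma kernels_cap (u : 'rV[C]_n) : u *m W = 0 -> u *m conj W = 0 -> u = 0.
Proof.
move=> /sub_kermxP uK /sub_kermxP uL; apply/eqP; rewrite -submx0 -W_split.1.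
by rewrite sub_capmx; apply/andP; split; [exact: uK|exact: uL].
Qed.

Lemma kernels_dec (u : 'rV[C]_n) :
  exists a b, [/\ a *m W = 0, b *m conj W = 0 & u = a + b].
Proof.
have /sub_addsmxP[[x y] /= ->] : (u <= K + L)%MS by rewrite W_split.2 submx1.
by exists (x *m K), (y *m L); split; rewrite // -mulmxA mulmx_ker mulmx0.
Qed.

(** * Blocks of the family relative to K and L, with [P] and [Q] the projections on K and L *)

Section Blocks.
Variables P Q : 'M[C]_n.
Hypotheses (PW : P *m W = 0) (PcW : P *m conj W = conj W).
Hypotheses (QW : Q *m W = W) (QcW : Q *m conj W = 0) (QQ : Q *m Q = Q).

Lemma mulW_trP : W *m P^T = 0.
Proof. by apply: trmx_inj; rewrite trmx_mul trmxK W_alt mulmxN PW oppr0 trmx0. Qed.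

Lemma mulW_trQ : W *m Q^T = W.
Proof. by apply: trmx_inj; rewrite trmx_mul trmxK W_alt mulmxN QW. Qed.

Lemma mul_conjW_trQ : conj W *m Q^T = 0.
Proof.
by apply: trmx_inj; rewrite trmx_mul trmxK conjW_alt mulmxN QcW oppr0 trmx0.
Qed.

Lemma mul_conjW_trP : conj W *m P^T = conj W.
Proof. by apply: trmx_inj; rewrite trmx_mul trmxK conjW_alt mulmxN PcW. Qed.

(** Right multiplication by [Q^T] keeps [W] and kills its conjugate, and [P^T] does the opposite, so
    [u *m S = 0] puts [u] in both kernels. *)
Lemma realpart_unit_blocks : S \in unitmx.
Proof.
apply: unitmx_row_inj => u uS; apply: kernels_cap.
  by rewrite -mulW_trQ -[_ *m Q^T]addr0 -mul_conjW_trQ -mulmxDl mulmxA uS mul0mx.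
by rewrite -mul_conjW_trP -[_ *m P^T]add0r -mulW_trP -mulmxDl mulmxA uS mul0mx.
Qed.

(** [N z] is z varpi(z), cleared of its pole so that it makes sense at z = 0. [X z] is its L x L
    block, completed on K by a constant multiple of the conjugate of [W]; the determinant of [X z]
    thus tests invertibility of that block. *)
Let X z := - (Ci / 2) *: S + z *: (Q *m V *m Q^T).
Let N z := - (Ci / 2) *: W + z *: V - (Ci / 2 * z ^+ 2) *: conj W.

Lemma scaled_twistorE z : z != 0 -> N z = z *: twistor_mx W V z.
Proof.
move=> z0; rewrite /N /twistor_mx; apply/matrixP => i j; rewrite !mxE.
by move: (W i j) (V i j) (conjc _) => a b c; field; rewrite ?z0 ?pnatr_eq0.
Qed.

Lemma scaled_twistor_trQ z : N z *m Q^T = - (Ci / 2) *: W + z *: (V *m Q^T).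
Proof.
by rewrite /N !(mulmxDl, mulNmx) -!scalemxAl mulW_trQ mul_conjW_trQ scaler0 subr0.
Qed.

Lemma scaled_twistor_trP z : N z *m P^T = z *: (V *m P^T) - (Ci / 2 * z ^+ 2) *: conj W.
Proof.
by rewrite /N !(mulmxDl, mulNmx) -!scalemxAl mulW_trP mul_conjW_trP scaler0 add0r.
Qed.

Lemma mulQX z : Q *m X z = Q *m N z *m Q^T.
Proof.
rewrite -mulmxA scaled_twistor_trQ /X /S !mulmxDr -!scalemxAr mulmxDr QcW addr0 QW.
by rewrite !mulmxA QQ.
Qed.

Lemma mulX_trQ z : X z *m Q^T = Q *m N z *m Q^T.
Proof.
rewrite -mulmxA scaled_twistor_trQ /X /S !mulmxDl mulmxDr -!scalemxAl -!scalemxAr mulmxDl.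
by rewrite mul_conjW_trQ addr0 mulW_trQ QW -!mulmxA -trmx_mul QQ.
Qed.

(** When [X z] is invertible, the L x L block [Q *m X z] has rank at least that of [W], which is n/2
    and hence the rank of [N z]. So pairing with L alone already detects the kernel. *)
Lemma kernel_of_pairing z (k : nat) (u : 'M[C]_(k, n)) : z != 0 ->
  \det (X z) != 0 -> u *m (N z *m Q^T) = 0 -> u *m N z = 0.
Proof.
move=> z0 d0 uNQ; have Xu : X z \in unitmx by rewrite unitmxE unitfE.
apply/sub_kermxP; apply: submx_trans (@kermx_mulr_eq _ _ _ (N z) Q^T _).
  exact/sub_kermxP.
rewrite scaled_twistorE // mxrank_scale_nz // -scaled_twistorE //.
apply: (@leq_trans (\rank (Q *m N z *m Q^T))); last by rewrite -mulmxA mxrankM_maxr.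
rewrite -mulQX mxrankMfree ?row_free_unit //.
apply: (@leq_trans (\rank W)); last by rewrite -QW mxrankM_maxl.
have := rank_kernels_split W_split.
have := rank_kernels_split (twistor_split z0).
lia.
Qed.

(* A vector [v] of ker W has a correction [z a] in ker \bar W, rational in [z],
   such that [v + z a] pairs to 0 with ker \bar W; by equality of ranks it is
   then in the kernel, and pairing it with ker W gives the identity. *)
Lemma block_identity z : z != 0 -> \det (X z) != 0 ->
  \det (X z) *: (P *m V *m P^T)
  = z *: ((Ci / 2 * \det (X z)) *: conj W
          + P *m V *m Q^T *m \adj (X z) *m (Q *m V *m P^T)).
Proof.
move=> z0 d0; set d := \det _ in d0 *; set A := \adj _.
have Xu : X z \in unitmx by rewrite unitmxE unitfE.
(* The correction in L solves a linear system with matrix [X z]. Using the adjugate and scaling by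
   the determinant, instead of inverting, keeps everything polynomial in z. *)
pose u := d *: P - z *: (P *m V *m Q^T *m A *m Q).
have uNQ : u *m (N z *m Q^T) = 0.
  rewrite /u mulmxBl -!scalemxAl -[_ *m Q *m _]mulmxA (mulmxA Q) -mulX_trQ.
  rewrite [_ *m A *m _]mulmxA -(mulmxA _ A) mul_adj_mx -/d mul_mx_scalar.
  rewrite -!scalemxAl -[_ *m Q^T *m Q^T]mulmxA -trmx_mul QQ.
  rewrite scaled_twistor_trQ mulmxDr -!scalemxAr PW scaler0 add0r !scalerA mulmxA.
  by rewrite [z * d]mulrC subrr.
have uN := kernel_of_pairing z0 d0 uNQ.
have : u *m (N z *m P^T) = 0 by rewrite mulmxA uN mul0mx.
rewrite scaled_twistor_trP => h.
have PE : P *m (z *: (V *m P^T) - (Ci / 2 * z ^+ 2) *: conj W)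
    = z *: (P *m V *m P^T) - (Ci / 2 * z ^+ 2) *: conj W.
  by rewrite mulmxBr -!scalemxAr PcW mulmxA.
have QE : Q *m (z *: (V *m P^T) - (Ci / 2 * z ^+ 2) *: conj W)
    = z *: (Q *m V *m P^T).
  by rewrite mulmxBr -!scalemxAr QcW scaler0 subr0 mulmxA.
move: h; rewrite /u mulmxBl -!scalemxAl -[_ *m Q *m _]mulmxA PE QE -scalemxAr.
rewrite combine_blocks => /eqP.
by rewrite scaler_eq0 (negPf z0) subr_eq0 => /eqP.
Qed.

(** Entrywise, [block_identity] equates two polynomials in z away from the zeros of z det [X z],
    hence everywhere. At z = 0 the right side vanishes while det [X 0] does not. *)
Lemma block_V_eq0 : P *m V *m P^T = 0.
Proof.
pose Xp : 'M[{poly C}]_n := map_mx polyC (- (Ci / 2) *: S)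
  + 'X *: map_mx polyC (Q *m V *m Q^T).
have XpE z : map_mx (horner_eval z) Xp = X z.
  by apply/matrixP => i j; rewrite !mxE /horner_eval !hornerE mulrC.
have detE z : (\det Xp).[z] = \det (X z).
  by rewrite -XpE det_map_mx.
have d0 : \det (X 0) != 0.
  have := realpart_unit_blocks.
  rewrite unitmxE unitfE /X scale0r addr0 detZ mulf_eq0 negb_or => ->.
  by rewrite andbT expf_neq0 // oppr_eq0 mulf_neq0 ?Ci_neq0 ?invr_eq0 ?pnatr_eq0.
have dp0 : \det Xp != 0.
  by apply: contraNneq d0 => e; rewrite -detE e horner0.
apply/matrixP => i j; rewrite [RHS]mxE.
set A := P *m V *m Q^T; set B := Q *m V *m P^T.
pose q : {poly C} := \det Xp * ((P *m V *m P^T) i j)%:P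
  - 'X * ((Ci / 2)%:P * \det Xp * (conj W i j)%:P
          + (map_mx polyC A *m \adj Xp *m map_mx polyC B) i j).
have qE z : q.[z] = (\det (X z) *: (P *m V *m P^T)) i j
  - (z *: ((Ci / 2 * \det (X z)) *: conj W + A *m \adj (X z) *m B)) i j.
  have mE (D : 'M[C]_n) : map_mx (horner_eval z) (map_mx polyC D) = D.
    by apply/matrixP => k l; rewrite !mxE /horner_eval hornerC.
  have e : ((map_mx polyC A *m \adj Xp *m map_mx polyC B) i j).[z]
      = (A *m \adj (X z) *m B) i j.
    rewrite -[A in RHS]mE -[B in RHS]mE -XpE -map_mx_adj -!map_mxM.
    by rewrite [RHS]mxE.
  rewrite /q hornerD hornerN !hornerM hornerX hornerD !hornerM !hornerC e detE.
  by rewrite !mxE.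
have q0 : q = 0.
  apply: (@poly_eq0_cofinite _ _ ('X * \det Xp)); first by rewrite mulf_neq0 ?polyX_eq0.
  move=> z; rewrite hornerM hornerX detE mulf_eq0 negb_or => /andP[z0 dz].
  by rewrite qE block_identity // subrr.
(* Evaluation at the excluded point z = 0 is legitimate because [q] is the zero polynomial. *)
have := qE 0; rewrite q0 horner0 scale0r [in X in _ - X]mxE subr0 mxE.
by move/esym/eqP; rewrite mulf_eq0 (negPf d0) => /eqP.
Qed.

End Blocks.

Let P := proj_mx K L.
Let Q := 1%:M - P.

Lemma block_projections : [/\ P *m W = 0, P *m conj W = conj W,
  Q *m W = W, Q *m conj W = 0 & Q *m Q = Q].
Proof.
have PW : P *m W = 0 by apply/sub_kermxP; rewrite -[P]mul1mx proj_mx_sub.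
have QcW : Q *m conj W = 0.
  apply/sub_kermxP; rewrite /Q -[P]mul1mx; apply: proj_mx_compl_sub.
  by rewrite W_split.2 submx1.
have PP : P *m P = P by apply: proj_mx_id W_split.1 _; apply/sub_kermxP/PW.
move: (P) @Q PW PP QcW => T U TW TT UcW; split=> //.
- have -> : T = 1%:M - U by rewrite opprB addrC subrK.
  by rewrite mulmxBl mul1mx UcW subr0.
- by rewrite /U mulmxBl mul1mx TW subr0.
- by rewrite /U mulmxBr mulmx1 mulmxBl mul1mx TT subrr subr0.
Qed.

Lemma realpart_unit : S \in unitmx.
Proof.
case: block_projections => h1 h2 h3 h4 _.
exact: (realpart_unit_blocks h1 h2 h3 h4).
Qed.

Lemma form_kernel_eq0 (u v : 'rV[C]_n) :
  u *m W = 0 -> v *m W = 0 -> u *m V *m v^T = 0.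
Proof.
have PE (x : 'rV[C]_n) : x *m W = 0 -> x *m P = x.
  by move=> /sub_kermxP; apply: proj_mx_id W_split.1.
move=> hu hv; rewrite -(PE u hu) -(PE v hv) trmx_mul.
have -> : u *m P *m V *m (P^T *m v^T) = u *m (P *m V *m P^T) *m v^T.
  by rewrite !mulmxA.
case: block_projections => h1 h2 h3 h4 h5.
by rewrite (block_V_eq0 h1 h2 h3 h4 h5) mulmx0 mul0mx.
Qed.

Lemma form_conj_kernel_eq0 (u v : 'rV[C]_n) :
  u *m conj W = 0 -> v *m conj W = 0 -> u *m V *m v^T = 0.
Proof.
have cE (x : 'rV[C]_n) : x *m conj W = 0 -> conj x *m W = 0.
  by move=> h; rewrite -[W]conj_mxK -map_mxM h map_mx0.
move=> /cE hu /cE hv; rewrite -[RHS](map_mx0 (@conjc R)) -(form_kernel_eq0 hu hv).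
by rewrite !map_mxM -map_trmx !conj_mxK V_real.
Qed.

Lemma row_eq0_pairing (f : 'rV[C]_n) :
  (forall w : 'rV_n, w *m W = 0 -> f *m w^T = 0) ->
  (forall w : 'rV_n, w *m conj W = 0 -> f *m w^T = 0) -> f = 0.
Proof.
move=> hK hL; apply/rowP => j; rewrite [RHS]mxE.
have [a [b [aK bL e]]] := kernels_dec (delta_mx 0 j).
have : f *m (delta_mx 0 j : 'rV_n)^T = 0 by rewrite e linearD mulmxDr hK ?hL ?addr0.
rewrite trmx_delta -colE => /matrixP /(_ 0 0); rewrite !mxE; exact.
Qed.

Lemma alt_mul_tr (A : 'M[C]_n) (w : 'rV[C]_n) : A^T = - A -> w *m A = 0 -> A *m w^T = 0.
Proof.
by move=> hA h; apply: trmx_inj; rewrite trmx_mul trmxK hA mulmxN h oppr0 trmx0.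
Qed.

(** Once V(L, L) = 0 is known, [X z] is the constant invertible matrix -(i/2) S, so
    [kernel_of_pairing] applies to every nonzero z without exception. *)
Lemma twistor_kernelP z (u : 'rV[C]_n) : z != 0 ->
  (forall w : 'rV_n, w *m conj W = 0 -> u *m twistor_mx W V z *m w^T = 0) ->
  u *m twistor_mx W V z = 0.
Proof.
move=> z0 h; case: block_projections => h1 h2 h3 h4 h5.
have QVQ : Q *m V *m Q^T = 0.
  apply: mx_eq0_bilinear => x y.
  have -> : x *m (Q *m V *m Q^T) *m y^T = x *m Q *m V *m (y *m Q)^T.
    by rewrite trmx_mul !mulmxA.
  by apply: form_conj_kernel_eq0; rewrite -mulmxA h4 mulmx0.
apply: (scalerI z0); rewrite scaler0 scalemxAr -scaled_twistorE //.
apply: (kernel_of_pairing h3 h4 h5) => //.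
  rewrite QVQ scaler0 addr0 -unitfE -unitmxE unitmxZ ?realpart_unit //.
  by rewrite unitfE oppr_eq0 mulf_neq0 ?Ci_neq0 ?invr_eq0 ?pnatr_eq0.
rewrite scaled_twistorE // -scalemxAl -scalemxAr mulmxA.
suff -> : u *m twistor_mx W V z *m Q^T = 0 by rewrite scaler0.
apply: mx_eq0_bilinear => x y.
have -> : x *m (u *m twistor_mx W V z *m Q^T) *m y^T
    = x *m (u *m twistor_mx W V z *m (y *m Q)^T) by rewrite trmx_mul !mulmxA.
rewrite h ?mulmx0 //.
by rewrite -mulmxA h4 mulmx0.
Qed.

(** For a value a = kappa v in L the conjugate of [W] drops out of a S, so the defining equation a W
    = -2i v V becomes a S = -2i v V, solvable on the whole space. *)
Definition kappa_mx : 'M[C]_n := - (2 * Ci) *: (V *m invmx S).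

(** * The equations of kappa on K *)

Section KappaOnKernel.
Variable v : 'rV[C]_n.
Hypothesis vW : v *m W = 0.
Let a := v *m kappa_mx.

Lemma kappa_realpart : a *m S = - (2 * Ci) *: (v *m V).
Proof.
by rewrite /a /kappa_mx -scalemxAr -scalemxAl mulmxA mulmxKV ?realpart_unit.
Qed.

(** It suffices to pair with K and L. Against L the conjugate of [W] vanishes; against K it agrees
    with [S], which gives a multiple of V(K, K) = 0. *)
Lemma kappa_conjW : a *m conj W = 0.
Proof.
apply: row_eq0_pairing => w hw; last first.
  by rewrite -mulmxA (alt_mul_tr conjW_alt hw) mulmx0.
have -> : a *m conj W *m w^T = a *m S *m w^T.
  by rewrite /S mulmxDr mulmxDl -(mulmxA a W) (alt_mul_tr W_alt hw) mulmx0 add0r.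
by rewrite kappa_realpart -scalemxAl form_kernel_eq0 // scaler0.
Qed.

Lemma kappa_W : a *m W = - (2 * Ci) *: (v *m V).
Proof. by rewrite -kappa_realpart /S mulmxDr kappa_conjW addr0. Qed.

(** The defining equation of kappa cancels [v *m V]; the remainder is z times the defect in the
    second equation of part (c). *)
Lemma kappa_sum z : z != 0 ->
  (v + z *: a) *m twistor_mx W V z
  = z *: (a *m V - (Ci / 2) *: (v *m conj W)).
Proof.
move=> z0.
have vT : v *m twistor_mx W V z = v *m V - (Ci / 2 * z) *: (v *m conj W).
  by rewrite /twistor_mx mulmxBr mulmxDr -!scalemxAr vW scaler0 add0r.
have aT : a *m twistor_mx W V z = - (Ci / (2 * z)) *: (a *m W) + a *m V.
  by rewrite /twistor_mx mulmxBr mulmxDr -!scalemxAr kappa_conjW scaler0 subr0.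
rewrite mulmxDl -scalemxAl vT aT kappa_W scalerA scalerDr scalerA.
have -> : z * (- (Ci / (2 * z)) * - (2 * Ci)) = -1.
  rewrite mulrNN -(Ci_sqr R); move: (Ci : C) => i.
  by field; rewrite ?z0 ?pnatr_eq0.
rewrite scaleN1r scalerBr scalerA [z * (_ / _)]mulrC.
by rewrite addrACA subrr add0r addrC.
Qed.

(** By [twistor_kernelP] only pairings with L matter, and there both terms of [kappa_sum] vanish,
    the first because [a] lies in L. *)
Lemma kappa_twistor z : z != 0 -> (v + z *: a) *m twistor_mx W V z = 0.
Proof.
move=> z0; apply: twistor_kernelP => // w hw.
rewrite kappa_sum // -scalemxAl mulmxBl -scalemxAl.
rewrite -(mulmxA v (conj W)) (alt_mul_tr conjW_alt hw) mulmx0 scaler0 subr0.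
by rewrite form_conj_kernel_eq0 ?scaler0 // kappa_conjW.
Qed.

Lemma kappa_V : a *m V = (Ci / 2) *: (v *m conj W).
Proof.
have := kappa_twistor (oner_neq0 _); rewrite kappa_sum ?oner_neq0 // scale1r.
by move/eqP; rewrite subr_eq0 => /eqP.
Qed.

(** On K the conjugate of [W] equals [S], so [kappa_V] reads a V = (i/2) v S; the factor -2i cancels
    i/2. *)
Lemma kappaK_kernel : a *m kappa_mx = v.
Proof.
have -> : a *m kappa_mx = - (2 * Ci) *: (a *m V *m invmx S).
  by rewrite /kappa_mx -scalemxAr mulmxA.
have -> : a *m V = (Ci / 2) *: (v *m S).
  by rewrite kappa_V /S mulmxDr vW add0r.
rewrite -scalemxAl mulmxK ?realpart_unit // scalerA.
suff -> : - (2 * Ci) * (Ci / 2) = 1 :> C by rewrite scale1r.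
have -> : - (2 * Ci) * (Ci / 2) = - (Ci * Ci) :> C.
  by move: (Ci : C) => i; field; rewrite ?pnatr_eq0.
by rewrite Ci_sqr opprK.
Qed.

End KappaOnKernel.

Lemma conj_kappa : conj kappa_mx = - kappa_mx.
Proof.
have cS : conj S = S by rewrite /S map_mxD conj_mxK addrC.
have cZ (c : C) (A : 'M[C]_n) : conj (c *: A) = conjc c *: conj A.
  by apply/matrixP => i j; rewrite !mxE conjcE.
rewrite /kappa_mx cZ map_mxM map_invmx cS V_real.
have -> : conjc (- (2 * Ci)) = 2 * Ci :> C.
  by rewrite !conjcE conjc_Ci mulrN opprK.
by rewrite scaleNr opprK.
Qed.

(** On K this is [kappaK_kernel]. On L it follows by conjugation: [kappa_mx] is purely imaginary,
    and the sign disappears in the square. *)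
Lemma kappa_sqr : kappa_mx *m kappa_mx = 1%:M.
Proof.
apply/row_matrixP => i; rewrite !rowE mulmx1.
have [x [y [xK yL ->]]] := kernels_dec (delta_mx 0 i).
rewrite mulmxA 2!mulmxDl kappaK_kernel //; congr (_ + _).
have cy : conj y *m W = 0 by rewrite -[W]conj_mxK -map_mxM yL map_mx0.
have := congr1 (map_mx (@conjc R)) (kappaK_kernel cy).
by rewrite !map_mxM conj_mxK conj_kappa !mulmxN mulNmx opprK.
Qed.

Lemma kappa_unit : kappa_mx \in unitmx.
Proof. by have [] := mulmx1_unit kappa_sqr. Qed.

Lemma kappa_kernels : (K *m kappa_mx :=: L)%MS.
Proof.
have h : (K *m kappa_mx <= L)%MS.
  apply/row_subP => i; apply/sub_kermxP; rewrite row_mul kappa_conjW //.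
  by rewrite -row_mul mulmx_ker row0.
apply/eqmxP; rewrite -(geq_leqif (mxrank_leqif_eq h)).
have -> : \rank L = \rank K by rewrite /L -map_kermx mxrank_map.
have -> // : \rank (K *m kappa_mx) = \rank K.
by apply: mxrankMfree; rewrite row_free_unit kappa_unit.
Qed.

(** One inclusion is [kappa_twistor]; the other is a dimension count. The map 1 + z kappa is
    injective on K, since u = -z kappa u would lie in both K and L. *)
Lemma kappa_twistor_kernel z : z != 0 ->
  (kermx (twistor_mx W V z) :=: K *m (1%:M + z *: kappa_mx))%MS.
Proof.
move=> z0; apply: eqmx_sym.
have h : (K *m (1%:M + z *: kappa_mx) <= kermx (twistor_mx W V z))%MS.
  apply/row_subP => i; apply/sub_kermxP.
  have -> : row i (K *m (1%:M + z *: kappa_mx))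
      = row i K + z *: (row i K *m kappa_mx).
    by rewrite row_mul mulmxDr mulmx1 -scalemxAr.
  by apply: kappa_twistor => //; rewrite -row_mul mulmx_ker row0.
apply/eqmxP; rewrite -(geq_leqif (mxrank_leqif_eq h)) (mxrank_ker (twistor_mx W V z)).
have -> : \rank (K *m (1%:M + z *: kappa_mx)) = \rank K.
  apply/mxrank_injP; rewrite -submx0; apply/rV_subP => u.
  rewrite sub_capmx => /andP[/sub_kermxP uK /sub_kermxP].
  rewrite mulmxDr mulmx1 -scalemxAr => /eqP; rewrite addr_eq0 => /eqP e.
  rewrite [u]kernels_cap ?sub0mx //.
  by rewrite e mulNmx -scalemxAl (kappa_conjW uK) scaler0 oppr0.
rewrite (mxrank_ker W).
have := rank_kernels_split W_split.
have := rank_kernels_split (twistor_split z0).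
lia.
Qed.

Lemma kappaP (v w : 'rV[C]_n) : v *m W = 0 -> w *m conj W = 0 ->
  (w *m W = - (2 * Ci) *: (v *m V) <-> w = v *m kappa_mx).
Proof.
move=> vW wL; split=> [e|->]; last exact: kappa_W.
rewrite -[w](mulmxK realpart_unit) {1}/S mulmxDr wL addr0 e /kappa_mx.
by rewrite -scalemxAl -scalemxAr mulmxA.
Qed.

(** The invertible [kappa_mx] factors through [V]. *)
Lemma twistor_V_nondeg (v : 'rV[C]_n) : v *m V = 0 -> v = 0.
Proof.
move=> h; rewrite -[v](mulmxK kappa_unit) {1}/kappa_mx -scalemxAr mulmxA h.
by rewrite mul0mx scaler0 mul0mx.
Qed.

End TwistorAlgebra.

(** * Smooth functions *)

(** Differentiability depends only on the germ: the first-order expansion of [f] at [a] also serves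
    for [g]. *)
Lemma near_eq_differentiable (R : numFieldType) (V W : normedModType R)
    (f g : V -> W) (a : V) :
  {near a, f =1 g} -> differentiable f a -> differentiable g a.
Proof.
move=> fg df; have ga := nbhs_singleton fg.
have e : g \o shift a = cst (g a) + 'd f a +o_ 0 id.
  apply/eqaddoP => eps eps0; have := diff_locally df.
  move/eqaddoP => /(_ eps eps0) h.
  have fg0 : \forall h \near (0 : V), f (h + a) = g (h + a).
    by move: fg; rewrite (near_shift 0 a) /= subr0; apply.
  apply: filterS2 h fg0 => y h1 h2.
  have <- : (f \o shift a - (cst (f a) + 'd f a)) y
      = (g \o shift a - (cst (g a) + 'd f a)) y; last exact: h1.
  change (f (y + a) - (f a + 'd f a y) = g (y + a) - (g a + 'd f a y)).
  by rewrite h2 ga.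
apply/diff_locallyP; have dc := diff_continuous df.
by rewrite (diff_unique dc e).
Qed.

(** * Real-valued functions: sums, products and inverses *)

Section RealSmooth.
Local Open Scope classical_set_scope.
Local Open Scope ring_scope.
Variables (R : realType) (n : nat).
Implicit Types (U : set 'rV[R]_n) (f g : 'rV[R]_n -> R).

Lemma diffn_on_subset (V : normedModType R) k U U' (f : 'rV[R]_n -> V) :
  U' `<=` U -> diffn_on k U f -> diffn_on k U' f.
Proof.
move=> s; elim: k f => [//|k IH] f /= [h1 h2]; split=> [x /s|v]; first exact: h1.
exact: IH.
Qed.

Lemma diffn_onS (V : normedModType R) k U (f : 'rV[R]_n -> V) :
  diffn_on k.+1 U f -> diffn_on k U f.
Proof.
elim: k f => [//|k IH] f [h1 h2]; split=> // v.
exact/IH/h2.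
Qed.

Lemma diffn_on_cst k U (a : R) : diffn_on k U (fun=> a).
Proof.
elim: k a => [//|k IH] a /=; split=> [x _|v]; first exact: differentiable_cst.
have -> : (fun x : 'rV[R]_n => 'D_v (fun=> a) x) = (fun=> 0); last exact: IH.
by apply/funext => x; exact: derive_cst.
Qed.

(** On an open set, agreement of functions is agreement of germs, so it passes to derivatives and
    the induction on the order proceeds. *)
Lemma diffn_on_ext (V : normedModType R) k U (f g : 'rV[R]_n -> V) :
  open U -> (forall x, U x -> f x = g x) -> diffn_on k U f -> diffn_on k U g.
Proof.
move=> oU; elim: k f g => [//|k IH] f g fg [h1 h2].
have nfg x : U x -> {near x, f =1 g}.
  by move=> Ux; apply: filterS (open_nbhs_nbhs (conj oU Ux)); exact: fg.
split=> [x Ux|v]; first exact: near_eq_differentiable (nfg x Ux) (h1 x Ux).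
apply: IH (h2 v) => x /nfg; exact: near_eq_derive.
Qed.

Lemma diffn_onD k U f g : open U ->
  diffn_on k U f -> diffn_on k U g -> diffn_on k U (fun x => f x + g x).
Proof.
move=> oU; elim: k f g => [//|k IH] f g [f1 f2] [g1 g2].
split=> [x Ux|v]; first by apply: differentiableD; [exact: f1|exact: g1].
apply: diffn_on_ext oU _ (IH _ _ (f2 v) (g2 v)) => x Ux /=.
by apply/esym/deriveD; apply: diff_derivable; [exact: f1|exact: g1].
Qed.

Lemma diffn_onM k U f g : open U ->
  diffn_on k U f -> diffn_on k U g -> diffn_on k U (fun x => f x * g x).
Proof.
move=> oU; elim: k f g => [//|k IH] f g hf hg.
have [f1 f2] := hf; have [g1 g2] := hg.
split=> [x Ux|v]; first by apply: differentiableM; [exact: f1|exact: g1].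
have h := diffn_onD oU (IH _ _ (diffn_onS hf) (g2 v))
  (IH _ _ (diffn_onS hg) (f2 v)).
apply: diffn_on_ext oU _ h => x Ux /=.
by apply/esym/deriveM; apply: diff_derivable; [exact: f1|exact: g1].
Qed.

Lemma diffn_onV k U f : open U -> (forall x, U x -> f x != 0) ->
  diffn_on k U f -> diffn_on k U (fun x => (f x)^-1).
Proof.
move=> oU f0; elim: k f f0 => [//|k IH] f f0 hf; have [f1 f2] := hf.
split=> [x Ux|v]; first by apply: differentiableV; [exact: f1|exact: f0].
have hV := IH f f0 (diffn_onS hf).
(* The derivative of 1/f is -(1/f)(1/f) f', which involves 1/f only to the order already covered by
   induction. *)
have h := diffn_onM oU (diffn_on_cst _ _ (-1))
  (diffn_onM oU (diffn_onM oU hV hV) (f2 v)).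
apply: diffn_on_ext oU _ h => x Ux /=.
rewrite deriveV; [|exact: f0|by apply: diff_derivable; exact: f1].
by rewrite -[RHS]/(_ * _) mulN1r mulNr expr2 invfM.
Qed.

End RealSmooth.

(** * Complex-valued functions and matrices *)

Section ComplexSmooth.
Local Open Scope classical_set_scope.
Local Open Scope ring_scope.
Variables (R : realType) (n : nat) (U : set 'rV[R]_n).
Hypothesis oU : open U.
Implicit Types f g : 'rV[R]_n -> R[i].

Lemma csmooth_on_ext f g : (forall x, U x -> f x = g x) ->
  csmooth_on U f -> csmooth_on U g.
Proof.
move=> fg [h1 h2]; split=> k;
  [apply: diffn_on_ext oU _ (h1 k)|apply: diffn_on_ext oU _ (h2 k)];
  by move=> x /fg ->.
Qed.

Lemma csmooth_on_cst (a : R[i]) : csmooth_on U (fun=> a).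
Proof. by split=> k; exact: diffn_on_cst. Qed.

Lemma csmooth_onD f g : csmooth_on U f -> csmooth_on U g ->
  csmooth_on U (fun x => f x + g x).
Proof.
move=> [f1 f2] [g1 g2]; split=> k.
  apply: diffn_on_ext oU _ (diffn_onD oU (f1 k) (g1 k)) => x _.
  by case: (f x) (g x) => [? ?] [? ?].
apply: diffn_on_ext oU _ (diffn_onD oU (f2 k) (g2 k)) => x _.
by case: (f x) (g x) => [? ?] [? ?].
Qed.

Lemma csmooth_onM f g : csmooth_on U f -> csmooth_on U g ->
  csmooth_on U (fun x => f x * g x).
Proof.
move=> [f1 f2] [g1 g2]; split=> k.
  have h := diffn_onD oU (diffn_onM oU (f1 k) (g1 k))
    (diffn_onM oU (diffn_on_cst _ _ (-1))
      (diffn_onM oU (f2 k) (g2 k))).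
  apply: diffn_on_ext oU _ h => x _.
  by case: (f x) (g x) => [? ?] [? ?] /=; rewrite mulN1r.
have h := diffn_onD oU (diffn_onM oU (f1 k) (g2 k))
  (diffn_onM oU (f2 k) (g1 k)).
apply: diffn_on_ext oU _ h => x _.
by case: (f x) (g x) => [? ?] [? ?] /=.
Qed.

Lemma csmooth_on_conj f : csmooth_on U f -> csmooth_on U (fun x => conjc (f x)).
Proof.
move=> [f1 f2]; split=> k.
  by apply: diffn_on_ext oU _ (f1 k) => x _; case: (f x).
apply: diffn_on_ext oU _ (diffn_onM oU (diffn_on_cst _ _ (-1)) (f2 k)) => x _.
by case: (f x) => [? ?] /=; rewrite mulN1r.
Qed.

(** The inverse is the conjugate divided by the squared modulus [N], which reduces to the real
    case. *)
Lemma csmooth_onV f : (forall x, U x -> f x != 0) -> csmooth_on U f ->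
  csmooth_on U (fun x => (f x)^-1).
Proof.
move=> f0 hf; have [n1 n2] := csmooth_onM hf (csmooth_on_conj hf).
pose N x := complex.Re (f x * conjc (f x)).
have NE x : f x * conjc (f x) = (N x)%:C.
  rewrite /N; case: (f x) => a b; apply/eqP; rewrite eq_complex /= eqxx /=.
  by apply/eqP; ring.
have hN : csmooth_on U (fun x => (N x)^-1%:C).
  split=> k /=; last exact: diffn_on_cst.
  apply: diffn_onV oU _ (n1 k) => x Ux; apply/eqP => N0.
  have := NE x; rewrite /N N0 => /eqP; rewrite mulf_eq0 conjc_eq0 orbb.
  by rewrite (negPf (f0 x Ux)).
apply: csmooth_on_ext (csmooth_onM (csmooth_on_conj hf) hN) => x Ux.
have fx := f0 x Ux; apply: (mulfI fx); rewrite mulfV // mulrA NE.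
rewrite -rmorphM mulfV //; apply/eqP => N0; move: (NE x); rewrite N0 => /eqP.
by rewrite mulf_eq0 conjc_eq0 orbb (negPf fx).
Qed.

Lemma csmooth_on_sum (I : Type) (r : seq I) (F : I -> 'rV[R]_n -> R[i]) :
  (forall i, csmooth_on U (F i)) -> csmooth_on U (fun x => \sum_(i <- r) F i x).
Proof.
move=> hF; elim: r => [|i r IH].
  by apply: csmooth_on_ext (csmooth_on_cst 0) => x _; rewrite big_nil.
by apply: csmooth_on_ext (csmooth_onD (hF i) IH) => x _; rewrite big_cons.
Qed.

Lemma csmooth_on_prod (I : Type) (r : seq I) (F : I -> 'rV[R]_n -> R[i]) :
  (forall i, csmooth_on U (F i)) -> csmooth_on U (fun x => \prod_(i <- r) F i x).
Proof.
move=> hF; elim: r => [|i r IH].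
  by apply: csmooth_on_ext (csmooth_on_cst 1) => x _; rewrite big_nil.
by apply: csmooth_on_ext (csmooth_onM (hF i) IH) => x _; rewrite big_cons.
Qed.

Lemma csmooth_on_mulmx m k l (A : 'rV[R]_n -> 'M[R[i]]_(m, k))
    (B : 'rV[R]_n -> 'M[R[i]]_(k, l)) :
  (forall i j, csmooth_on U (fun x => A x i j)) ->
  (forall i j, csmooth_on U (fun x => B x i j)) ->
  forall i j, csmooth_on U (fun x => (A x *m B x) i j).
Proof.
move=> hA hB i j; apply: csmooth_on_ext (csmooth_on_sum (index_enum _)
  (F := fun k x => A x i k * B x k j) _) => [x _|p]; first by rewrite mxE.
exact: csmooth_onM.
Qed.

Lemma csmooth_on_det m (A : 'rV[R]_n -> 'M[R[i]]_m) :
  (forall i j, csmooth_on U (fun x => A x i j)) -> csmooth_on U (fun x => \det (A x)).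
Proof.
move=> hA; rewrite /determinant; apply: csmooth_on_sum => s.
apply: csmooth_onM; first exact: csmooth_on_cst.
by apply: csmooth_on_prod.
Qed.

Lemma csmooth_on_invmx m (A : 'rV[R]_n -> 'M[R[i]]_m) :
  (forall x, U x -> A x \in unitmx) ->
  (forall i j, csmooth_on U (fun x => A x i j)) ->
  forall i j, csmooth_on U (fun x => invmx (A x) i j).
Proof.
move=> Au hA i j.
have h : csmooth_on U (fun x => (\det (A x))^-1 * cofactor (A x) j i).
  apply: csmooth_onM.
    apply: csmooth_onV; last exact: csmooth_on_det.
    by move=> x /Au; rewrite unitmxE unitfE.
  rewrite /cofactor; apply: csmooth_onM; first exact: csmooth_on_cst.
  apply: csmooth_on_det => k l.
  apply: csmooth_on_ext (hA (lift j k) (lift i l)) => x _; rewrite !mxE //.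
apply: csmooth_on_ext h => x Ux.
by rewrite /invmx Au // !mxE.
Qed.

End ComplexSmooth.

(** * Tensors in charts *)

(** Both Gram matrices transform by [B] on the left and [B^T] on the right. In the quotient the
    factors [B^T] cancel, leaving the conjugation law of an endomorphism. *)
Lemma change_basis_ratio (F : comUnitRingType) (n : nat) (B T : 'M[F]_n)
    (v : 'rV[F]_n) (w s : 'M[F]_n) : B *m T = 1%:M -> s \in unitmx ->
  v *m (w *m invmx s) *m T = v *m T *m (B *m w *m B^T) *m invmx (B *m s *m B^T).
Proof.
move=> BT su; have TB := mulmx1C BT; have [Bu _] := mulmx1_unit BT.
have Su : B *m s *m B^T \in unitmx by rewrite !unitmx_mul Bu su unitmx_tr.
apply: (can_inj (mulmxK Su)); rewrite mulmxKV // !mulmxA.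
by rewrite -!(mulmxA _ T B) TB !mulmx1 mulmxKV.
Qed.

Section Charts.
Local Open Scope classical_set_scope.
Local Open Scope ring_scope.
Variables (R : realType) (n : nat) (M : manifold R n).
Implicit Types (c d : chart R n M) (U : set M) (p : M).
Local Notation C := R[i].

Lemma near_chart c U p : open U -> cdom c p -> U p ->
  \forall y \near cmap c p, exists q, [/\ cdom c q, U q & y = cmap c q].
Proof.
move=> oU cp Up.
have h1 : \forall y \near cmap c p, (cmap c @` cdom c) y.
  by apply: open_nbhs_nbhs; split; [exact: cimg_open|exists p].
have h2 : \forall y \near cmap c p, U (cinv c y).
  by apply: (cinv_cts cp); rewrite /= (cmapK cp); apply: open_nbhs_nbhs.
apply: filterS2 h1 h2 => y [q cq <-]; rewrite (cmapK cq) => Uq.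
by exists q.
Qed.

Lemma open_chart_image c U : open U -> open (cmap c @` (cdom c `&` U)).
Proof.
move=> oU; rewrite openE => _ [p [cp Up] <-].
apply: filterS (near_chart oU cp Up) => y [q [cq Uq ->]].
by exists q.
Qed.

Lemma transition_differentiable c d p : atlas c -> atlas d ->
  cdom c p -> cdom d p -> differentiable (cmap d \o cinv c) (cmap c p).
Proof.
move=> ac ad cp dp; have [h _] := transition_smooth ac ad 1.
by apply: h; exists p.
Qed.

(** The chain rule for two opposite transition maps, whose composite is the identity near
    [cmap c p]. *)
Lemma jacobian_transitionK c d p : atlas c -> atlas d -> cdom c p -> cdom d p ->
  'J (cmap d \o cinv c) (cmap c p) *m 'J (cmap c \o cinv d) (cmap d p) = 1%:M.
Proof.
move=> ac ad cp dp.
have df := transition_differentiable ac ad cp dp.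
have dg := transition_differentiable ad ac dp cp.
have fx : (cmap d \o cinv c) (cmap c p) = cmap d p by rewrite /= (cmapK cp).
have dg' : differentiable (cmap c \o cinv d) ((cmap d \o cinv c) (cmap c p)).
  by rewrite fx.
set f := cmap d \o cinv c in df fx dg' *; set g := cmap c \o cinv d in dg dg' *.
have gf : {near cmap c p, g \o f =1 id}.
  apply: filterS (near_chart (cdom_open d) cp dp) => _ [q [cq dq ->]] /=.
  by rewrite /f /g /= (cmapK cq) (cmapK dq).
have comp_id (u : 'rV[R]_n) : 'd (g \o f) (cmap c p) u = u.
  have dgf := differentiable_comp df dg'.
  exact: etrans (esym (deriveE u dgf)) (etrans (near_eq_derive u gf) (derive_id _ _)).
have chain (u : 'rV[R]_n) : 'd g (cmap d p) ('d f (cmap c p) u) = u.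
  have e := congr1 (fun h : 'rV[R]_n -> 'rV[R]_n => h u) (diff_comp df dg').
  move: (etrans (esym e) (comp_id u)) => {e} /=.
  by move: (f (cmap c p)) fx => y ->.
apply/row_matrixP => i; rewrite !rowE mulmx1 mulmxA.
exact: etrans (etrans (mul_rV_lin1 _ _) (congr1 _ (mul_rV_lin1 _ _))) (chain _).
Qed.

Lemma chart_jacobians c p : atlas c -> cdom c p ->
  cplx (of_chart c p) *m cplx (to_chart c p) = 1%:M.
Proof.
move=> ac cp; have [ad dp] := chart_atP p.
have e : of_chart c p *m to_chart c p = 1%:M by exact: jacobian_transitionK.
by rewrite -[RHS](map_mx1 (real_complex R)) -e map_mxM.
Qed.

Lemma is_form2_conj (w : cform2 M) : is_form2 w -> is_form2 (conj_form2 w).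
Proof.
move=> [alt sm]; split=> [p|c ac i j].
  by rewrite /conj_form2 map_trmx alt map_mxN.
have oc : open (cmap c @` cdom c) by exact: cimg_open.
apply: (csmooth_on_ext oc _ (csmooth_on_conj oc (sm c ac i j))) => x _.
rewrite /form2_in /conj_form2; set B := cplx _.
have cB : map_mx (@conjc R) B = B.
  by apply/matrixP => k l; rewrite !mxE /= oppr0.
have -> : B *m map_mx (@conjc R) (w (cinv c x)) *m B^T
    = map_mx (@conjc R) (B *m w (cinv c x) *m B^T).
  by rewrite !map_mxM -map_trmx cB.
by rewrite [RHS]mxE.
Qed.

Lemma is_form2D (w w' : cform2 M) : is_form2 w -> is_form2 w' ->
  is_form2 (fun p => w p + w' p).
Proof.
move=> [alt sm] [alt' sm']; split=> [p|c ac i j].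
  by rewrite linearD /= alt alt' opprD.
have oc : open (cmap c @` cdom c) by exact: cimg_open.
apply: (csmooth_on_ext oc _ (csmooth_onD oc (sm c ac i j) (sm' c ac i j))) => x _.
by rewrite /form2_in mulmxDr mulmxDl [RHS]mxE.
Qed.

Lemma csmooth_on_subset (A B : set 'rV[R]_n) (f : 'rV[R]_n -> C) :
  A `<=` B -> csmooth_on B f -> csmooth_on A f.
Proof.
by move=> AB [h1 h2]; split=> k;
  [exact: diffn_on_subset AB (h1 k)|exact: diffn_on_subset AB (h2 k)].
Qed.

(** In any chart the coordinates of the new field are products of those of [V], the Gram matrix of
    [w] and the inverse Gram matrix of [s], the last smooth by Cramer's formula. *)
Lemma smooth_field_ratio U (V : cfield M) (a : C) (w s : cform2 M) :
  open U -> is_form2 w -> is_form2 s -> (forall p, s p \in unitmx) ->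
  smooth_field U V ->
  smooth_field U (fun p => V p *m (a *: (w p *m invmx (s p)))).
Proof.
move=> oU [_ hw] [_ hs] su hV c ac j.
have oc := open_chart_image (c := c) oU; set D := cmap c @` _ in oc *.
have sub : D `<=` cmap c @` cdom c by move=> _ [q [cq _] <-]; exists q.
have rest f : csmooth_on (cmap c @` cdom c) f -> csmooth_on D f.
  exact: csmooth_on_subset.
pose S x := form2_in c s x.
have BT x : D x -> cplx (of_chart c (cinv c x)) *m cplx (to_chart c (cinv c x)) = 1%:M.
  by move=> [q [cq Uq] <-]; rewrite (cmapK cq); exact: chart_jacobians.
have SE x : D x -> S x \in unitmx.
  move=> /BT h1; rewrite /S /form2_in; have [Bu _] := mulmx1_unit h1.
  move: (cplx _) Bu (s _) (su (cinv c x)) => B Bu A Au.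
  by rewrite !unitmx_mul Bu Au unitmx_tr.
pose F x := field_in c V x *m form2_in c w x *m invmx (S x).
have hF i : csmooth_on D (fun x => F x 0 i).
  apply: csmooth_on_mulmx => // [k l|]; last first.
    by apply: csmooth_on_invmx => // k l; exact/rest/hs.
  apply: csmooth_on_mulmx => // [k' l'|k' l']; last exact/rest/hw.
  by rewrite ord1; exact: hV.
apply: (csmooth_on_ext oc _ (csmooth_onM oc (csmooth_on_cst D a) (hF j))) => x Dx.
have h1 := BT x Dx.
have e := change_basis_ratio (V (cinv c x)) (w (cinv c x)) h1 (su (cinv c x)).
have -> : field_in c (fun p => V p *m (a *: (w p *m invmx (s p)))) x
    = a *: (V (cinv c x) *m (w (cinv c x) *m invmx (s (cinv c x)))
            *m cplx (to_chart c (cinv c x))).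
  by rewrite scalemxAl scalemxAr.
by rewrite e [RHS]mxE.
Qed.

End Charts.

(** * Twistor families of holomorphic symplectic forms *)

Lemma assoc_cplx_conj (R : realType) (n : nat) (M : manifold R n) (w : cform2 M) p :
  kernels_split (w p) -> assoc_cplx (conj_form2 w) p = - assoc_cplx w p.
Proof.
move=> hs; have hc : kernels_split (conj_form2 w p) by exact: kernels_split_conj.
exact: (is_assoc_at_inj hc (assoc_cplxP hc) (is_assoc_at_conj (assoc_cplxP hs))).
Qed.

Section TwistorForms.
Variables (R : realType) (n : nat) (M : manifold R n) (wp w3 : cform2 M).
Hypothesis hwp : hol_symplectic wp.
Hypothesis w3_real : conj_form2 w3 = w3.
Hypothesis hvarpi : forall z : R[i], z != 0 -> hol_symplectic (varpi wp w3 z).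

Lemma twistor_form_split z p : kernels_split (twistor_form wp w3 z p).
Proof.
have [_ _ hs] := hwp; case: z => [z|] /=; last exact: kernels_split_conj.
case: ifPn => [_|z0]; first exact: hs.
by have [_ _] := hvarpi z0; exact.
Qed.

Lemma twistor_form_antipode z :
  twistor_form wp w3 (antipode z) = conj_form2 (twistor_form wp w3 z).
Proof.
case: z => [z|] /=; last first.
  by rewrite eqxx; apply/funext => p; rewrite /conj_form2 conj_mxK.
case: eqVneq => [//|z0] /=.
rewrite oppr_eq0 invr_eq0 conjc_eq0 (negPf z0); apply/funext => p.
apply/esym/conj_twistor_mx => //.
exact: (congr1 (fun w : cform2 M => w p) w3_real).
Qed.

Lemma T01_Jtw z p : (T01 (Jtw wp w3 z) p :=: kermx (twistor_form wp w3 z p))%MS.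
Proof. exact: (assoc_cplxP (twistor_form_split z p)).1. Qed.

Lemma T10_Jtw z p :
  (T10 (Jtw wp w3 z) p :=: kermx (conj_form2 (twistor_form wp w3 z) p))%MS.
Proof. exact: (assoc_cplxP (twistor_form_split z p)).2. Qed.

End TwistorForms.

Unset Implicit Arguments.

Theorem mainTheorem2 (R : realType) (n : nat) (M : manifold R n)
    (wp w3 : cform2 M)
    (hwp : hol_symplectic wp)
    (hw3 : is_form2 w3)
    (w3_real : conj_form2 w3 = w3)
    (hvarpi : forall z : R[i], z != 0 -> hol_symplectic (varpi wp w3 z)) :
  let J := Jtw wp w3 in
  let J0 := J (Some 0) in
  [/\ (forall (z : option R[i]) (p : M), J (antipode z) p = - J z p),
      is_form11 J0 w3 /\ nondegenerate_form2 w3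
    & exists kappa : cendo M,
      [/\ bundle_iso (T01 J0) (T10 J0) kappa,
          (forall (z : R[i]) (p : M),
            (T01 (J (Some z)) p :=: T01 J0 p *m (1%:M + z *: kappa p))%MS),
          (forall (p : M) (v w : 'rV[R[i]]_n),
            (v <= T01 J0 p)%MS -> (w <= T10 J0 p)%MS ->
            (w *m wp p = - (2 * Ci) *: (v *m w3 p) <-> w = v *m kappa p))
        & (forall (p : M) (v : 'rV[R[i]]_n), (v <= T01 J0 p)%MS ->
            v *m kappa p *m w3 p = (Ci / 2) *: (v *m conj_form2 wp p))]].
Proof.
move=> J J0.
have [fwp _ swp] := hwp.
have altw p : (wp p)^T = - wp p by case: fwp.
have re3 p : map_mx (@conjc R) (w3 p) = w3 p.
  exact: (congr1 (fun w : cform2 M => w p) w3_real).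
have split p z : z != 0 -> kernels_split (twistor_mx (wp p) (w3 p) z).
  by move=> z0; have [_ _] := hvarpi z z0; exact.
have form0 : twistor_form wp w3 (Some 0) = wp by rewrite /= eqxx.
have k01 p : (T01 J0 p :=: kermx (wp p))%MS.
  by have := T01_Jtw hwp hvarpi (Some 0) p; rewrite form0.
have k10 p : (T10 J0 p :=: kermx (map_mx (@conjc R) (wp p)))%MS.
  by have := T10_Jtw hwp hvarpi (Some 0) p; rewrite form0.
have in01 p (v : 'rV_n) : (v <= T01 J0 p)%MS -> v *m wp p = 0.
  by rewrite k01 => /sub_kermxP.
have in10 p (v : 'rV_n) : (v <= T10 J0 p)%MS -> v *m map_mx (@conjc R) (wp p) = 0.
  by rewrite k10 => /sub_kermxP.
pose kappa : cendo M := fun p => kappa_mx (wp p) (w3 p).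
have kk p : kappa p *m kappa p = 1%:M.
  exact: (kappa_sqr (altw p) (re3 p) (swp p) (split p)).
split.
- move=> z p; rewrite /J /Jtw twistor_form_antipode //.
  by apply: assoc_cplx_conj; exact: twistor_form_split.
- split; last first.
    move=> p v; exact: (twistor_V_nondeg (altw p) (re3 p) (swp p) (split p)).
  split=> // p u v /orP[] /andP[].
    move=> /in10 hu /in10 hv.
    exact: (form_conj_kernel_eq0 (altw p) (re3 p) (swp p) (split p)).
  move=> /in01 hu /in01 hv.
  exact: (form_kernel_eq0 (altw p) (swp p) (split p)).
- exists kappa; split.
  + split=> [p|U V oU VE].
      split; last first.
        apply/eqP; rewrite -submx0; apply/rV_subP => u.
        rewrite sub_capmx => /andP[_ /sub_kermxP uk].
        by rewrite -[u]mulmx1 -(kk p) mulmxA uk mul0mx sub0mx.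
      apply: eqmx_trans (eqmxMr _ (k01 p)) _.
      apply: eqmx_trans (eqmx_sym (k10 p)).
      exact: (kappa_kernels (altw p) (re3 p) (swp p) (split p)).
    have sm V' : smooth_field U V' -> smooth_field U (fun p => V' p *m kappa p).
      have su p : wp p + conj_form2 wp p \in unitmx.
        exact: (realpart_unit (altw p) (swp p)).
      have hS := is_form2D fwp (is_form2_conj fwp).
      exact: (smooth_field_ratio (- (2 * Ci)) oU hw3 hS su).
    split; first exact: sm.
    (* As kappa is an involution, the converse is the same implication applied to the image
       field. *)
    move/sm; congr smooth_field; apply/funext => p.
    by rewrite -mulmxA kk mulmx1.
  (* At z = 0 the form is [wp] itself and 1 + z kappa is the identity, so this case is separate. *)
  + move=> z p; have [->|z0] := eqVneq z 0.
      by rewrite scale0r addr0 mulmx1; apply: eqmx_refl.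
    apply: eqmx_trans (T01_Jtw hwp hvarpi (Some z) p) _.
    rewrite /= (negPf z0).
    apply: eqmx_trans (eqmx_sym (eqmxMr _ (k01 p))).
    exact: (kappa_twistor_kernel (altw p) (re3 p) (swp p) (split p)).
  + move=> p v w /in01 hv /in10 hw.
    exact: (kappaP (altw p) (swp p) (split p)).
  + move=> p v /in01 hv.
    exact: (kappa_V (altw p) (re3 p) (swp p) (split p)).
Qed.
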